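(* Let $n$ voters run the process $CUD(\mathcal{F}^{IMaj}_\sigma,\tau)$ with majority threshold $\sigma\in(\frac n2,n]$ and deadline $\tau$, with consistent utility functions (all lazy consistent or all proactive consistent). Then in every run either the set of possible winners at time $t=\tau$ is empty and the outcome is the default alternative $\psi$, or a valid (i.e. non-default) alternative becomes the winner at some time $t\in\{0,1,\dots,\tau\}$.
   Context: Setting (Consensus Under a Deadline, CUD). $V=\{1,\dots,n\}$ is a finite set of $n$ voters, $C$ is a finite set of $m+1$ alternatives containing a default alternative $\psi$; $C^+=C\setminus\{\psi\}$ is the set of valid alternatives ($|C^+|=m\ge 1$). Each voter $i$ has a truthful preference $a_i$, a strict linear order on $C$; $a_i(c,c')$ means that $i$ prefers $c$ to $c'$. It is assumed that $a_i(c,\psi)$ for all $i\in V$, $c\in C^+$. For nonempty $W\subseteq C$, $\mathrm{top}_i(W)$ is the $a_i$-best element of $W$. The deadline $\tau$ is a nonnegative integer and the threshold $\sigma$ is an integer with $\frac n2<\sigma\le n$. Time $t$ counts the remaining steps, running down from $\tau$ to $0$. Scores. For a ballot profile $b^t=(b^t_1,\dots,b^t_n)\in C^n$, $s^t_c=|\{i\in V: b^t_i=c\}|$, and $s^t=(s^t_c)_{c\in C^+}$ is the score vector. For a score vector $s$ and $c\in C$, $s+c$ (resp. $s-c$) is $s$ with the score of $c$ increased (resp. decreased) by 1. Possible winners and voting rule. $\widehat W(s,t)=\{c\in C^+ : \sigma-s_c<t+1\}$ is the set of possible winners. $\mathcal F(s,t)=\mathcal F^{IMaj}_\sigma(s,t)$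 equals $\{\psi\}$ if $\widehat W(s,t)=\emptyset$ and equals $\widehat W(s,t)$ otherwise. Utilities. Each voter has a utility $u_i(s,t)\in\mathbb R$ on score vectors $s$ and times $t\in\{0,\dots,\tau\}$. With $w=\mathrm{top}_i(\mathcal F(s,t))$ and $w'=\mathrm{top}_i(\mathcal F(s',t))$: $u_i$ is lazy consistent if for all $s,s',t$: $u_i(s,t)>u_i(s',t)\iff a_i(w,w')$; $u_i$ is proactive consistent if for all $s,s',t$: $u_i(s,t)>u_i(s',t)\iff a_i(w,w')$ or ($w=w'$ and $s_w>s'_w$), where for $w=w'=\psi$ neither side is strictly better. Either all voters are lazy consistent or all are proactive consistent. Process. Initially $t=\tau$ and $b^\tau_i=\mathrm{top}_i(C)$ for all $i$. At time $t$: if $\mathcal F(s^t,t)=\{w\}$ is a singleton, the process stops and $w$ is the outcome (the winner if $w\in C^+$; the default if $w=\psi$). Otherwise each voter $i$ computes a best response $w_i\in\arg\max_{c\in C}u_i(s^t-b^t_i+c,\,t-1)$, where $w_i=b_i^t$ if $b_i^t$ is itself a maximizer (a voter changes only for a strict improvement), and otherwise ties among maximizers are broken by $a_i$ (the $a_i$-best maximizer is chosen). Let $I=\{i: w_i\ne b^t_i\}$. If $I\neq\emptyset$, one $j\in I$ is chosen uniformly at random and $b^{t-1}_j=w_j$, $b^{t-1}_i=b^t_i$ for $i\ne j$; if $I=\emptyset$, $b^{t-1}=b^t$. Then $t$ is replaced by $t-1$. At $t=0$ the set $\mathcal F(s^0,0)$ is always a singleton because $\sigma>n/2$. A run is any realization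 of the random choices. *)

(* Defs.v *)
From HB Require Import structures.
From mathcomp Require Import all_boot all_order all_algebra.
From mathcomp Require Import reals.

Set Implicit Arguments.
Unset Strict Implicit.
Unset Printing Implicit Defensive.

Import Order.TTheory GRing.Theory Num.Theory.

Definition strict_linear_order (C : Type) (r : rel C) : Prop :=
  [/\ irreflexive r, transitive r & forall x y, x <> y -> r x y \/ r y x].

Notation valid psi := {c | c != psi}.

Notation profile n C := {ffun 'I_n -> C}.

(* The default alternative [psi] has no score: a score vector has one
   coordinate per valid alternative. *)
Notation score_vector psi := {ffun valid psi -> nat}.

Definition score (n : nat) (C : finType) (psi : C) (b : profile n C) :
    score_vector psi :=
  [ffun c => #|[set i | b i == val c]|].

(* Adding or removing a vote for [psi] changes no coordinate. *)
Definition add_vote (C : finType) (psi : C) (s : score_vector psi) (c : C) :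
    score_vector psi :=
  [ffun d => s d + (val d == c)].

(* The truncated subtraction is never triggered by the process, in which a vote
   is only removed from an alternative that some voter votes for. *)
Definition remove_vote (C : finType) (psi : C) (s : score_vector psi) (c : C) :
    score_vector psi :=
  [ffun d => s d - (val d == c)].

(* [top psi r W] is the [r]-best element of [W]; the value [psi] for an empty
   [W] is a junk value. *)
Definition top (C : finType) (psi : C) (r : rel C) (W : {set C}) : C :=
  odflt psi [pick w in W | [forall w' in W, (w' != w) ==> r w w']].

(* Since [0 < t + 1], truncated and integer subtraction give the same set. *)
Definition possible_winners (C : finType) (psi : C) (sigma : nat)
    (s : score_vector psi) (t : nat) : {set C} :=
  [set val c | c : valid psi & sigma - s c < t + 1].

Definition imaj (C : finType) (psi : C) (sigma : nat)
    (s : score_vector psi) (t : nat) : {set C} :=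
  if possible_winners sigma s t == set0 then [set psi]
  else possible_winners sigma s t.

(* In both notions of consistency, [s] and [s'] range over the score vectors of
   the ballot profiles of the [n] voters. *)
Definition lazy_consistent (R : realType) (n : nat) (C : finType) (psi : C)
    (sigma tau : nat) (r : rel C) (u : score_vector psi -> nat -> R) : Prop :=
  forall (b b' : profile n C) (t : nat), t <= tau ->
    let s := score psi b in
    let s' := score psi b' in
    let w := top psi r (imaj sigma s t) in
    let w' := top psi r (imaj sigma s' t) in
    (u s t > u s' t)%R <-> r w w'.

Definition proactive_consistent (R : realType) (n : nat) (C : finType) (psi : C)
    (sigma tau : nat) (r : rel C) (u : score_vector psi -> nat -> R) : Prop :=
  forall (b b' : profile n C) (t : nat), t <= tau ->
    let s := score psi b in
    let s' := score psi b' in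
    let w := top psi r (imaj sigma s t) in
    let w' := top psi r (imaj sigma s' t) in
    (u s t > u s' t)%R <->
      r w w' \/
      exists c : valid psi, [/\ w = val c, w' = val c & s c > s' c].

Definition maximizers (R : realType) (n : nat) (C : finType) (psi : C)
    (u : 'I_n -> score_vector psi -> nat -> R) (b : profile n C) (t : nat)
    (i : 'I_n) : {set C} :=
  let value c := u i (add_vote (remove_vote (score psi b) (b i)) c) t.-1 in
  [set c | [forall d, (value d <= value c)%R]].

Definition best_response (R : realType) (n : nat) (C : finType) (psi : C)
    (a : 'I_n -> rel C) (u : 'I_n -> score_vector psi -> nat -> R)
    (b : profile n C) (t : nat) (i : 'I_n) : C :=
  if b i \in maximizers u b t i then b i
  else top psi (a i) (maximizers u b t i).

Definition improvers (R : realType) (n : nat) (C : finType) (psi : C)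
    (a : 'I_n -> rel C) (u : 'I_n -> score_vector psi -> nat -> R)
    (b : profile n C) (t : nat) : {set 'I_n} :=
  [set i | best_response a u b t i != b i].

(* [cud_step a u t b b'] : some realization of the random choice made at time
   [t > 0] takes the profile [b] at time [t] to [b'] at time [t.-1]. *)
Definition cud_step (R : realType) (n : nat) (C : finType) (psi : C)
    (a : 'I_n -> rel C) (u : 'I_n -> score_vector psi -> nat -> R)
    (t : nat) (b b' : profile n C) : Prop :=
  if improvers a u b t == set0 then b' = b
  else exists2 j, j \in improvers a u b t &
       b' = [ffun i => if i == j then best_response a u b t j else b i].

Definition stops_at (n : nat) (C : finType) (psi : C) (sigma : nat)
    (b : profile n C) (t : nat) : Prop :=
  exists w, imaj sigma (score psi b) t = [set w].

(* A run ending at time [T], where [b t] is the profile at time [t]; the values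
   of [b] outside of [T, tau] are irrelevant. A run is complete: it goes on until
   the process stops or the deadline is reached. That the process has also
   stopped in the latter case is not built in. *)
Definition cud_run (R : realType) (n : nat) (C : finType) (psi : C)
    (sigma tau : nat) (a : 'I_n -> rel C)
    (u : 'I_n -> score_vector psi -> nat -> R)
    (b : nat -> profile n C) (T : nat) : Prop :=
  [/\ T <= tau,
      b tau = [ffun i => top psi (a i) setT],
      forall t, T < t <= tau ->
        ~ stops_at psi sigma (b t) t /\ cud_step a u t (b t) (b t.-1)
    & stops_at psi sigma (b T) T \/ T = 0].

(* In a run with ballots [b] that ends at time [T], the process stops at time
   [t] with outcome [w]. *)
Definition outcome_at (n : nat) (C : finType) (psi : C) (sigma : nat)
    (b : nat -> profile n C) (T t : nat) (w : C) : Prop :=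
  t = T /\ imaj sigma (score psi (b t)) t = [set w].

(* Main.v *)
(* If two alternatives are possible winners, then every voter can vote for one of
   them that she does not support yet, which keeps it a possible winner after one
   step. As every voter ranks [psi] last, all her best responses keep some
   alternative possible, and so does the realized step: either one voter moves to
   a best response, or every current ballot is a best response. *)

Require Import Defs.
From HB Require Import structures.
From mathcomp Require Import all_boot all_order all_algebra.
From mathcomp Require Import reals.

Set Implicit Arguments.
Unset Strict Implicit.
Unset Printing Implicit Defensive.

Import Order.TTheory.

Section Top.
Variables (C : finType) (psi : C) (r : rel C).
Hypothesis r_order : strict_linear_order r.

Lemma top_in (W : {set C}) : W != set0 -> top psi r W \in W.
Proof.
case: r_order => r_irr r_tr r_tot /set0Pn[x0 Wx0]; rewrite /top.
case: pickP => [w /andP[] //|no_max].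
(* Take [w] in [W] beating the most elements of [C]. A [w'] in [W] that beats [w] would by
   transitivity beat all of these and [w] as well, hence strictly more. *)
case: (arg_maxnP (fun w => #|[set x | r w x]|) Wx0) => w Ww w_max.
have /negP[] := negbT (no_max w); rewrite [w \in W]Ww /=.
apply/forall_inP => w' Ww'; apply/implyP => ne_w'w.
have /r_tot[//|r_w'w] : w <> w' by apply/eqP; rewrite eq_sym.
have := w_max w' Ww'; rewrite /geq /= leqNgt => /negP[].
apply/proper_card/properP; split.
  by apply/subsetP => x; rewrite !inE; apply: r_tr.
by exists w; rewrite !inE ?r_irr.
Qed.

End Top.

Section Step.
Variables (n : nat) (C : finType) (psi : C) (sigma : nat).
Implicit Types (b : profile n C) (s : score_vector psi).

Definition switch b (i : 'I_n) (c : C) : profile n C :=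
  [ffun j => if j == i then c else b j].

Lemma switch_id b i : switch b i (b i) = b.
Proof. by apply/ffunP => j; rewrite ffunE; case: eqP => [->|]. Qed.

(** Consistency speaks only of scores of ballot profiles; this puts the score vectors compared in
    [maximizers] in that form. Truncation is harmless, since voter [i] is counted in the score of
    [b i] when that is valid. *)
Lemma score_switch b i c :
  score psi (switch b i c) = add_vote (remove_vote (score psi b) (b i)) c.
Proof.
apply/ffunP => d; rewrite !ffunE.
rewrite (cardsD1 i [set j | b j == val d]) (cardsD1 i) !inE ffunE !eqxx.
rewrite ![_ == val d]eq_sym addKn addnC; congr addn.
by apply: eq_card => j; rewrite !inE ffunE; case: eqP.
Qed.

Lemma mem_possible_winners s t (c : valid psi) :
  (val c \in possible_winners sigma s t) = (sigma <= s c + t).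
Proof.
rewrite mem_imset ?inE; last exact: val_inj.
by rewrite addn1 ltnS leq_subLR.
Qed.

Lemma possible_winners_valid s t c :
  c \in possible_winners sigma s t -> exists v : valid psi, c = val v.
Proof. by case/imsetP => v _ ->; exists v. Qed.

Lemma imaj_neq0 s t : imaj sigma s t != set0.
Proof.
rewrite /imaj; case: ifP => [_|->//].
by apply/set0Pn; exists psi; rewrite inE.
Qed.

(** The vote gained makes up for the step lost. *)
Lemma possible_winners_switch b t i (c : valid psi) : 0 < t ->
  val c \in possible_winners sigma (score psi b) t -> b i != val c ->
  val c \in possible_winners sigma (score psi (switch b i (val c))) t.-1.
Proof.
move=> t_gt0; rewrite !mem_possible_winners score_switch !ffunE eqxx eq_sym.
by move=> + /negPf->; rewrite subn0 -addnA add1n prednK.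
Qed.

Lemma two_possible_winners b t i :
  possible_winners sigma (score psi b) t != set0 ->
  ~ stops_at psi sigma b t ->
  exists2 c : valid psi,
    val c \in possible_winners sigma (score psi b) t & b i != val c.
Proof.
move=> PW_n0 no_stop; pose PW := possible_winners sigma (score psi b) t.
have [|] := boolP (PW \subset [set b i]); last first.
  case/subsetPn => c PWc; rewrite inE eq_sym => ne_c.
  by have [v def_c] := possible_winners_valid PWc; exists v; rewrite -def_c.
rewrite subset1 (negPf PW_n0) orbF => /eqP PW1.
by case: no_stop; exists (b i); rewrite /imaj (negPf PW_n0).
Qed.

(** At time 0 a possible winner already has [sigma] votes. Two of them would have disjoint sets of
    supporters, so [2 * sigma <= n]. *)
Lemma stops_at_deadline b : n < 2 * sigma -> stops_at psi sigma b 0.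
Proof.
move=> sigma_gt; rewrite /stops_at /imaj.
case: ifPn => [_|/set0Pn[c PWc]]; first by exists psi.
exists c; apply/eqP; rewrite eqEsubset sub1set PWc andbT.
apply/subsetP => d PWd; rewrite inE; apply/negPn/negP => ne_dc.
have [[v def_c] [v' def_d]] :=
  (possible_winners_valid PWc, possible_winners_valid PWd).
move: PWc PWd; rewrite def_c def_d !mem_possible_winners !addn0 !ffunE.
move=> sc sd; have := leq_add sc sd; rewrite addnn -mul2n leqNgt => /negP[].
apply: leq_ltn_trans sigma_gt; rewrite -cardsUI.
rewrite [_ :&: _](_ : _ = set0) ?cards0 ?addn0.
  by rewrite -[n in _ <= n]card_ord max_card.
apply/setP => i; rewrite !inE; apply/negP => /andP[/eqP-> /eqP eq_cd].
by rewrite def_c def_d eq_cd eqxx in ne_dc.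
Qed.

Section Voters.
Variables (R : realType) (tau : nat) (a : 'I_n -> rel C).
Variable u : 'I_n -> score_vector psi -> nat -> R.
Hypothesis a_order : forall i, strict_linear_order (a i).
Hypothesis a_psi : forall i c, c != psi -> a i c psi.
Hypothesis consistent :
  (forall i, lazy_consistent n sigma tau (a i) (u i)) \/
  (forall i, proactive_consistent n sigma tau (a i) (u i)).

Lemma best_response_maximizer b t i :
  best_response a u b t i \in maximizers u b t i.
Proof.
rewrite /best_response; case: ifP => // _; apply: top_in => //.
pose value c := u i (add_vote (remove_vote (score psi b) (b i)) c) t.-1.
(* Here [psi] only witnesses that [C] is inhabited; the maximum ranges over all of [C]. *)
apply/set0Pn; exists [arg max_(c > psi) value c]%O.
by case: arg_maxP => // c _ c_max; rewrite inE; apply/forallP => d; apply: c_max.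
Qed.

(** The top of [imaj] is [psi] for [b] and valid for [b'], and under either notion of consistency a
    preferred top forces a strictly larger utility. *)
Lemma utility_lt b b' i t : t <= tau ->
  possible_winners sigma (score psi b) t = set0 ->
  possible_winners sigma (score psi b') t != set0 ->
  (u i (score psi b) t < u i (score psi b') t)%R.
Proof.
move=> le_t PW0 PW'n0.
have top_psi : top psi (a i) (imaj sigma (score psi b) t) = psi.
  by have := top_in psi (a_order i) (imaj_neq0 (score psi b) t);
    rewrite {2}/imaj PW0 eqxx inE => /eqP.
have a_top : a i (top psi (a i) (imaj sigma (score psi b') t))
                 (top psi (a i) (imaj sigma (score psi b) t)).
  rewrite top_psi; apply: a_psi.
  have := top_in psi (a_order i) (imaj_neq0 (score psi b') t).
  by rewrite {2}/imaj (negPf PW'n0) => /possible_winners_valid[v ->]; exact: valP v.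
by case: consistent => cons; apply/(cons i b' b t le_t) => //; left.
Qed.

Lemma possible_winners_best_response b t i : 0 < t <= tau ->
  possible_winners sigma (score psi b) t != set0 -> ~ stops_at psi sigma b t ->
  possible_winners sigma (score psi (switch b i (best_response a u b t i))) t.-1
    != set0.
Proof.
case/andP=> t_gt0 le_t PW_n0 /(two_possible_winners i PW_n0)[c PWc ne_c].
have := best_response_maximizer b t i; rewrite inE => /forallP/(_ (val c)).
(* If the best response left no possible winner, voting for [c] would be strictly better, against
   maximality. *)
rewrite -!score_switch leNgt; apply: contraNneq => PW0.
apply: utility_lt => //; first exact: leq_trans (leq_pred t) le_t.
by apply/set0Pn; exists (val c); apply: possible_winners_switch.
Qed.

Lemma possible_winners_step b b' t : 0 < n -> 0 < t <= tau ->
  possible_winners sigma (score psi b) t != set0 -> ~ stops_at psi sigma b t ->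
  cud_step a u t b b' ->
  possible_winners sigma (score psi b') t.-1 != set0.
Proof.
move=> n_gt0 t_in PW_n0 no_stop; rewrite /cud_step.
have PW' i := possible_winners_best_response i t_in PW_n0 no_stop.
case: eqP => [no_improver ->|_ [j _ ->]]; last exact: PW'.
(* With no improver the profile stays put, which is any voter switching to her own best response;
   [0 < n] supplies such a voter. *)
have /eqP br_id : best_response a u b t (Ordinal n_gt0) == b (Ordinal n_gt0).
  by apply/negPn; have := in_set0 (Ordinal n_gt0); rewrite -no_improver inE => ->.
by have := PW' (Ordinal n_gt0); rewrite br_id switch_id.
Qed.

End Voters.

End Step.

Theorem theorem1 (R : realType) (n m : nat) (C : finType) (psi : C)
    (sigma tau : nat) (a : 'I_n -> rel C)
    (u : 'I_n -> score_vector psi -> nat -> R)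
    (m_ge1 : 1 <= m) (cardC : #|C| = m.+1)
    (a_order : forall i, strict_linear_order (a i))
    (a_psi : forall i c, c != psi -> a i c psi)
    (sigma_gt : n < 2 * sigma) (sigma_le : sigma <= n)
    (consistent :
      (forall i, lazy_consistent n sigma tau (a i) (u i)) \/
      (forall i, proactive_consistent n sigma tau (a i) (u i)))
    (b : nat -> profile n C) (T : nat)
    (run : cud_run sigma tau a u b T) :
  (possible_winners sigma (score psi (b tau)) tau = set0 /\
   exists t, t <= tau /\ outcome_at psi sigma b T t psi) \/
  (exists (t : nat) (c : valid psi),
     t <= tau /\ outcome_at psi sigma b T t (val c)).
Proof.
have n_gt0 : 0 < n by case: (n) sigma_gt sigma_le => //; case: (sigma).
case: run => le_T _ steps stop.
have {}stop : stops_at psi sigma (b T) T.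
  by case: stop => // ->; apply: stops_at_deadline.
have [PW0|PW_n0] := eqVneq (possible_winners sigma (score psi (b tau)) tau) set0.
  left; split=> //; exists T; split=> //; split=> //.
  have stop_tau : imaj sigma (score psi (b tau)) tau = [set psi].
    by rewrite /imaj PW0 eqxx.
  have [<-//|ne_T] := eqVneq tau T.
  (* A run with [T < tau] would have continued past time [tau], where it must stop with [psi]. *)
  have [|no_stop _] := steps tau; last by case: no_stop; exists psi.
  by rewrite leqnn ltn_neqAle eq_sym ne_T le_T.
have PW_T : possible_winners sigma (score psi (b T)) T != set0.
  (* Time runs down, so the induction is on the number [k] of steps made since [tau]. *)
  suff PW_sub k : k <= tau - T ->
      possible_winners sigma (score psi (b (tau - k))) (tau - k) != set0.
    by rewrite -(subKn le_T); apply: PW_sub.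
  elim: k => [|k IHk] lt_k; first by rewrite subn0.
  have lt_T : T < tau - k by rewrite ltn_subCr.
  have [|no_stop step] := steps (tau - k); first by rewrite lt_T leq_subr.
  rewrite subnS.
  apply: (possible_winners_step a_order a_psi consistent n_gt0 _ _ no_stop step).
    by rewrite leq_subr (leq_ltn_trans _ lt_T).
  exact/IHk/ltnW.
right; case: stop => w imaj_w.
have [c def_w] : exists c : valid psi, w = val c.
  apply: (@possible_winners_valid _ _ sigma (score psi (b T)) T).
  by move: imaj_w; rewrite /imaj (negPf PW_T) => ->; rewrite inE.
by exists T, c; rewrite -def_w.
Qed.
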